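(* Let $b\ge 2$ and $m\ge 1$ be integers and let $N=b^m$. Let $P_N=\{x_0,\ldots,x_{b^m-1}\}\subseteq(0,1)^2$ be a $(0,m,2)$-net in base $b$. Put $z_n=\Phi(x_n)$ for $0\le n<b^m$ and $Z_N=\{z_0,\ldots,z_{b^m-1}\}\subseteq\mathbb{S}^2$. Then $$D_{b^m}(Z_N;\mathbb{S}^2,\Omega)\le \frac{b^2}{b+1}\,\frac{m}{b^m}+\frac{1}{b^m}\left(9+\frac{4}{b}\right)+\frac{1}{b^{2m}}\left(2b-1-\frac{4b+3}{(b+1)^2}\right)$$ and $$D^\ast_{b^m}(Z_N;\mathbb{S}^2,\Omega^\ast)\le \frac{b^2}{b+1}\,\frac{m}{4b^m}+\frac{1}{b^m}\left(\frac{9}{4}+\frac{1}{b}\right)+\frac{1}{b^{2m}}\left(\frac{b}{2}-\frac14-\frac{4b+3}{4(b+1)^2}\right).$$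
   Context: $\mathbb{S}^2$ is the unit sphere in $\mathbb{R}^3$. Nets: for integers $b\ge2$, $m\ge1$, a point set $P\subseteq[0,1)^2$ consisting of $b^m$ points is a $(0,m,2)$-net in base $b$ if for all nonnegative integers $d_1,d_2$ with $d_1+d_2=m$ and all integers $0\le a_i<b^{d_i}$ ($i=1,2$), the elementary interval $\prod_{i=1}^2\left[\frac{a_i}{b^{d_i}},\frac{a_i+1}{b^{d_i}}\right)$ contains exactly one point of $P$. Lifting map: $\Phi:[0,1]^2\to\mathbb{S}^2$, $\Phi(x_1,x_2)=\left(2\cos(2\pi x_1)\sqrt{x_2-x_2^2},\;2\sin(2\pi x_1)\sqrt{x_2-x_2^2},\;1-2x_2\right)$. Spherical rectangles: let $T:[0,1)\times[0,1]\to\mathbb{S}^2$, $T(\theta,\phi)=(\cos(2\pi\theta)\sin(\pi\phi),\sin(2\pi\theta)\sin(\pi\phi),\cos(\pi\phi))$. For $0\le\theta_1\le\theta_2\le1$ and $0\le\phi_1\le\phi_2\le1$ let $\Omega_{\theta_1,\theta_2,\phi_1,\phi_2}=\{T(\theta,\phi):\theta_1\le\theta<\theta_2,\ \phi_1\le\phi<\phi_2\}$, whose normalized area is $\Gamma_{\theta_1,\theta_2,\phi_1,\phi_2}=(\theta_2-\theta_1)\frac{\cos(\pi\phi_1)-\cos(\pi\phi_2)}{2}$. For $Z_N=\{z_0,\ldots,z_{N-1}\}\subseteq\mathbb{S}^2$ the extreme spherical rectangle discrepancy is $$D_N(Z_N;\mathbb{S}^2,\Omega)=\sup_{0\le\theta_1<\theta_2\le1,\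 0\le\phi_1<\phi_2\le1}\left|\frac1N\sum_{n=0}^{N-1}1_{z_n\in\Omega_{\theta_1,\theta_2,\phi_1,\phi_2}}-\Gamma_{\theta_1,\theta_2,\phi_1,\phi_2}\right|,$$ and the spherical rectangle star-discrepancy is $$D_N^\ast(Z_N;\mathbb{S}^2,\Omega^\ast)=\sup_{0\le\theta\le1,\ 0\le\phi\le1}\left|\frac1N\sum_{n=0}^{N-1}1_{z_n\in\Omega_{0,\theta,0,\phi}}-\Gamma_{0,\theta,0,\phi}\right|.$$ Here $1_{z\in A}$ equals $1$ if $z\in A$ and $0$ otherwise. *)

(* Defs.v *)
From HB Require Import structures.
From mathcomp Require Import all_boot all_order all_algebra.
From mathcomp Require Import all_classical all_reals all_analysis.
From mathcomp Require Import ring.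

Set Implicit Arguments.
Unset Strict Implicit.
Unset Printing Implicit Defensive.

Import Order.TTheory GRing.Theory Num.Theory.

Local Open Scope classical_set_scope.
Local Open Scope ring_scope.

Definition vec3 (R : realType) (x y z : R) : 'rV[R]_3 :=
  \row_(i < 3) [:: x; y; z]`_i.

Definition sphere2 (R : realType) : set 'rV[R]_3 :=
  [set v | \sum_(i < 3) v 0 i ^+ 2 = 1].

Definition elementary_interval (R : realType) (b d1 d2 a1 a2 : nat) :
    set (R * R) :=
  `[a1%:R / b%:R ^+ d1, a1.+1%:R / b%:R ^+ d1[ `*`
  `[a2%:R / b%:R ^+ d2, a2.+1%:R / b%:R ^+ d2[.

Definition is_0m2_net (R : realType) (b m : nat) (P : set (R * R)) : Prop :=
  [/\ P `<=` `[0, 1[ `*` `[0, 1[,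
      (P #= `I_(b ^ m))%card &
      forall d1 d2 a1 a2 : nat, (d1 + d2 = m)%N ->
        (a1 < b ^ d1)%N -> (a2 < b ^ d2)%N ->
        exists! p, (P `&` elementary_interval b d1 d2 a1 a2) p].

Definition Phi (R : realType) (x : R * R) : 'rV[R]_3 :=
  vec3 (2 * cos (2 * pi * x.1) * Num.sqrt (x.2 - x.2 ^+ 2))
       (2 * sin (2 * pi * x.1) * Num.sqrt (x.2 - x.2 ^+ 2))
       (1 - 2 * x.2).

(* Both angles are normalized: theta is the longitude divided by 2 pi, phi the
   colatitude divided by pi. *)
Definition sph (R : realType) (theta phi : R) : 'rV[R]_3 :=
  vec3 (cos (2 * pi * theta) * sin (pi * phi))
       (sin (2 * pi * theta) * sin (pi * phi))
       (cos (pi * phi)).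

Definition Omega (R : realType) (theta1 theta2 phi1 phi2 : R) : set 'rV[R]_3 :=
  [set sph theta phi | theta in `[theta1, theta2[ & phi in `[phi1, phi2[].

(* Normalized area of Omega on the unit sphere, for parameters in [0, 1]. *)
Definition Gamma (R : realType) (theta1 theta2 phi1 phi2 : R) : R :=
  (theta2 - theta1) * ((cos (pi * phi1) - cos (pi * phi2)) / 2).

Definition local_discr (R : realType) (N : nat) (z : 'I_N -> 'rV[R]_3)
    (theta1 theta2 phi1 phi2 : R) : R :=
  `| N%:R^-1 * \sum_(n < N) \1_(Omega theta1 theta2 phi1 phi2) (z n)
     - Gamma theta1 theta2 phi1 phi2 |.

(* In the next two definitions the values range over a nonempty subset of
   [0, 1], so sup is a genuine supremum. *)
Definition discr (R : realType) (N : nat) (z : 'I_N -> 'rV[R]_3) : R :=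
  sup [set r | exists theta1 theta2 phi1 phi2 : R,
    [/\ 0 <= theta1 < theta2, theta2 <= 1, 0 <= phi1 < phi2, phi2 <= 1 &
        r = local_discr z theta1 theta2 phi1 phi2]].

Definition star_discr (R : realType) (N : nat) (z : 'I_N -> 'rV[R]_3) : R :=
  sup [set r | exists theta phi : R,
    [/\ 0 <= theta <= 1, 0 <= phi <= 1 &
        r = local_discr z 0 theta 0 phi]].

Lemma vec3_sphere2 (R : realType) (x y z : R) :
  sphere2 (vec3 x y z) <-> x ^+ 2 + y ^+ 2 + z ^+ 2 = 1.
Proof. by rewrite /sphere2 /= !big_ord_recr big_ord0 /= !mxE /= add0r. Qed.

Lemma Phi_sphere2 (R : realType) (x : R * R) :
  0 <= x.2 <= 1 -> sphere2 (Phi x).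
Proof.
move=> /andP[x0 x1]; apply/vec3_sphere2.
have h : 0 <= x.2 - x.2 ^+ 2 by rewrite subr_ge0 expr2 ler_piMl.
rewrite !exprMn (sqr_sqrtr h) -mulrDl -mulrDr cos2Dsin2 mulr1.
ring.
Qed.

Lemma sph_sphere2 (R : realType) (theta phi : R) : sphere2 (sph theta phi).
Proof.
by apply/vec3_sphere2; rewrite !exprMn -mulrDl cos2Dsin2 mul1r addrC cos2Dsin2.
Qed.

(* Main.v *)
(* Phi is area preserving, so both discrepancies are those of the net itself for
   boxes [s, t) x [u, v), where v = cap_area psi.

   Fix the height v. All b-adic vertical strips of width b^-i contain j or j + 1
   points below v, with the same j. Let a strip have its left part, of relative
   width t, cut off, and compare the count in the part with t times the count in
   the strip. Splitting the strip into b children, the cut falls in one child,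
   at relative position y = b t - a; the contributions of j cancel, and the other
   children contribute at most step_cost b t y. The rate b^2 / (4 (b + 1)) per
   level comes from
     step_cost b t y <= b^2 / (4 (b + 1)) - (b / 2) (t - 1/2)^2
                                          + (b / 2) (y - 1/2)^2,
   whose quadratic terms telescope; equality holds for t + y = 1,
   |y - t| = 1 / (b + 1). *)

Require Import Defs.
From HB Require Import structures.
From mathcomp Require Import all_boot all_order all_algebra.
From mathcomp Require Import all_classical all_reals all_analysis.
From mathcomp Require Import ring lra.

Import Order.TTheory GRing.Theory Num.Theory.

Set Implicit Arguments.
Unset Strict Implicit.
Unset Printing Implicit Defensive.

Local Open Scope classical_set_scope.
Local Open Scope ring_scope.

(** * Real inequalities for one refinement level *)

(** Half the length of the error range in [slice_step], with [a = B * x - y] substituted. *)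
Definition step_cost (R : realType) (B x y : R) : R :=
  (B - 1) / 4 - B * (x - 2^-1) ^+ 2 + (x - 2^-1) * (y - 2^-1) + `|y - x| / 2.

(* The telescoping only starts at k = 1: carrying the potential down to k = 0
   would cost b / 8 instead of a constant. *)
Definition slice_bound (R : realType) (B : R) (k : nat) (x : R) : R :=
  if k is 0 then 2^-1 + `|x - 2^-1|
  else B ^+ 2 / (4 * (B + 1)) * k%:R + 5 / 4 - B / 2 * (x - 2^-1) ^+ 2.

Lemma slice_bound_step (R : realType) (B x y : R) (k : nat) :
  2 <= B -> 0 <= x <= 1 -> 0 <= y <= 1 ->
  step_cost B x y + slice_bound B k y <= slice_bound B k.+1 x.
Proof.
move=> hB /andP[x0 x1] /andP[y0 y1].
have [r hr cE] : exists2 r : R, r * (B + 1) = 1 &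
    B ^+ 2 / (4 * (B + 1)) = (B - 1) / 4 + r / 4.
  by exists (B + 1)^-1; field; lra.
have r0 : 0 < r by nra.
rewrite /step_cost /slice_bound cE; case: k => [|k].
  (* This reduces the quadratic term to the case [B = 2]. The constant [5 / 4] is fixed here: at
     [x = 1/2] and [y = 0] or [1], only [r / 4] is to spare. *)
  have : 0 <= (B - 2) * (x - 2^-1) ^+ 2 by rewrite mulr_ge0 ?sqr_ge0//; lra.
  have := sqr_ge0 (x - 2^-1).
  have [h1|h1] := ler0P (y - 2^-1); have [h2|h2] := ler0P (y - x).
  - have : 0 <= y * (2 - x) by apply: mulr_ge0; lra.
    lra.
  - have : 0 <= (y - x) * (1 - x) by apply: mulr_ge0; lra.
    lra.
  - have : 0 <= (x - y) * x by apply: mulr_ge0; lra.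
    lra.
  - have : 0 <= (1 - y) * (1 + x) by apply: mulr_ge0; lra.
    lra.
set w := `|y - x|.
have w2 : w ^+ 2 = (y - x) ^+ 2 by rewrite real_normK ?num_real.
have -> : k.+2%:R = k.+1%:R + 1 :> R by rewrite natr1.
(* The difference of the two sides is a sum of two squares. *)
suff : 0 <= (B - 1) / 4 * (x + y - 1) ^+ 2 + (B + 1) / 4 * (w - r) ^+ 2.
  have -> : (B + 1) / 4 * (w - r) ^+ 2 =
    (B + 1) / 4 * w ^+ 2 - (r * (B + 1)) * w / 2 + r * (r * (B + 1)) / 4 by field.
  by rewrite w2 hr; move: w k.+1%:R {w2} => w K; lra.
by apply: addr_ge0; apply: mulr_ge0; rewrite ?sqr_ge0//; lra.
Qed.

(** With [box] replaced by [y * mid], the multiples of [kap] add up to [kap * (a + y - B * x) = 0].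
    The rest is linear in the excesses of [l], [mid], [r] over their lower bounds; its largest and
    smallest values are opposite, again because [a + y = B * x], so [step_cost] bounds both
    sides. *)
Lemma slice_step (R : realType) (B a x y kap l mid r box e : R) :
  0 <= x <= 1 -> y = B * x - a ->
  kap * a <= l <= (kap + 1) * a -> kap <= mid <= kap + 1 ->
  kap * (B - 1 - a) <= r <= (kap + 1) * (B - 1 - a) ->
  `|box - y * mid| <= e ->
  `|l + box - x * (l + mid + r)| <= step_cost B x y + e.
Proof.
move=> /andP[x0 x1] yE /andP[l0 l1] /andP[m0 m1] /andP[r0 r1].
rewrite !ler_norml => /andP[e0 e1]; rewrite /step_cost.
(* Centring [mid] in its unit interval yields the term [|y - x| / 2] for both signs at once. *)
have : `|(y - x) * (mid - kap - 2^-1)| <= `|y - x| / 2.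
  by rewrite normrM ler_wpM2l// ler_norml; lra.
rewrite ler_norml => /andP[]; move: `|y - x| => w h0 h1.
have p1 : 0 <= (1 - x) * ((kap + 1) * a - l) by apply: mulr_ge0; lra.
have p2 : 0 <= (1 - x) * (l - kap * a) by apply: mulr_ge0; lra.
have p3 : 0 <= x * ((kap + 1) * (B - 1 - a) - r) by apply: mulr_ge0; lra.
have p4 : 0 <= x * (r - kap * (B - 1 - a)) by apply: mulr_ge0; lra.
have aE : a = B * x - y by lra.
subst a; apply/andP; split; nra.
Qed.

(** * Counting points in boxes *)

Definition rcount (R : realType) (N : nat) (x : 'I_N -> R * R) (s t u v : R) : R :=
  \sum_(n < N) (s <= (x n).1 < t)%R%:R * (u <= (x n).2 < v)%R%:R.

Lemma rcount_ge0 (R : realType) (N : nat) (x : 'I_N -> R * R) (s t u v : R) :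
  0 <= rcount x s t u v.
Proof. by apply: sumr_ge0 => n _; rewrite mulr_ge0. Qed.

Lemma natr_itv_cat (R : realType) (r s t z : R) : r <= s -> s <= t ->
  (r <= z < t)%R%:R = (r <= z < s)%R%:R + (s <= z < t)%R%:R :> R.
Proof.
move=> rs st; have [zs|sz] /= := ltP z s.
  by rewrite (lt_le_trans zs st) andbT addr0.
by rewrite (le_trans rs sz) add0r.
Qed.

Lemma rcount_catl (R : realType) (N : nat) (x : 'I_N -> R * R) (r s t u v : R) :
  r <= s -> s <= t -> rcount x r t u v = rcount x r s u v + rcount x s t u v.
Proof.
move=> rs st; rewrite /rcount -big_split; apply: eq_bigr => n _ /=.
by rewrite (natr_itv_cat _ rs st) mulrDl.
Qed.

Lemma rcount_catr (R : realType) (N : nat) (x : 'I_N -> R * R) (r s t u v : R) :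
  r <= s -> s <= t -> rcount x u v r t = rcount x u v r s + rcount x u v s t.
Proof.
move=> rs st; rewrite /rcount -big_split; apply: eq_bigr => n _ /=.
by rewrite (natr_itv_cat _ rs st) mulrDr.
Qed.

Lemma rcount_id (R : realType) (N : nat) (x : 'I_N -> R * R) (s u v : R) :
  rcount x s s u v = 0.
Proof.
by apply: (@addrI _ (rcount x s s u v)); rewrite -rcount_catl// addr0.
Qed.

Lemma rcount_idr (R : realType) (N : nat) (x : 'I_N -> R * R) (s u v : R) :
  rcount x u v s s = 0.
Proof.
by apply: (@addrI _ (rcount x u v s s)); rewrite -rcount_catr// addr0.
Qed.

(** * Nets and vertical strips *)

(** Both inequalities are weak so that [t = 1] can be put in the last cell. *)
Lemma nat_cell (R : realType) (n : nat) (t : R) : (0 < n)%N -> 0 <= t <= 1 ->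
  exists2 j, (j < n)%N & j%:R <= n%:R * t <= j.+1%:R.
Proof.
move=> n0 /andP[t0 t1]; have nt0 : 0 <= n%:R * t by rewrite mulr_ge0.
have [ltn|gen] := ltnP (Num.trunc (n%:R * t)) n.
  exists (Num.trunc (n%:R * t)) => //.
  by have /andP[-> /ltW] := truncn_itv nt0.
exists n.-1; rewrite prednK// ler_piMr// andbT.
by move: gen; rewrite truncn_ge_nat//; apply: le_trans; rewrite ler_nat leq_pred.
Qed.

(** The net axioms concern a set of points, the discrepancies a sum over indices. A repeated value
    would leave fewer than [N] distinct ones. *)
Lemma net_injective (R : realType) (N : nat) (x : 'I_N -> R * R) :
  (range x #= `I_N)%card -> injective x.
Proof.
move=> /card_fset_set xE; apply/injectiveP; rewrite /injectiveb /dinjectiveb.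
apply: contraT; rewrite -ltn_size_undup size_map -cardE card_ord ltnNge.
move=> /negP[].
apply: leq_trans (eq_leq (esym xE)) _.
apply: uniq_leq_size; first exact: finmap.fset_uniq.
move=> p; rewrite mem_undup.
have fx : finite_set (range x) by exact: finite_image.
rewrite in_fset_set// inE => -[n _ <-]; exact: codom_f.
Qed.

Lemma net_cell (R : realType) (b m : nat) (x : 'I_(b ^ m) -> R * R)
    (i k a d : nat) : is_0m2_net b m (range x) ->
  (i + k)%N = m -> (a < b ^ i)%N -> (d < b ^ k)%N ->
  rcount x (a%:R / b%:R ^+ i) (a.+1%:R / b%:R ^+ i)
           (d%:R / b%:R ^+ k) (d.+1%:R / b%:R ^+ k) = 1.
Proof.
move=> [_ /net_injective xI net] ik ai dk.
have [p [[[n _ xn] pE] pU]] := net _ _ _ _ ik ai dk.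
rewrite /rcount (bigD1 n)//= big1 => [|n' n'n].
  rewrite addr0 xn; move: pE; rewrite /elementary_interval /= !in_itv/=.
  by move=> [-> ->]; rewrite mulr1.
case: (boolP (_ <= (x n').1 < _)) => [h1|_]; last by rewrite mul0r.
case: (boolP (_ <= (x n').2 < _)) => [h2|_]; last by rewrite mulr0.
case/eqP: n'n; apply: xI; rewrite xn; apply/esym/pU; split; first by exists n'.
by rewrite /elementary_interval /= !in_itv/= h1.
Qed.

(** The region is a stack of [d] elementary intervals. *)
Lemma strip_rows (R : realType) (b m : nat) (x : 'I_(b ^ m) -> R * R)
    (i k a d : nat) : is_0m2_net b m (range x) ->
  (i + k)%N = m -> (a < b ^ i)%N -> (d <= b ^ k)%N ->
  rcount x (a%:R / b%:R ^+ i) (a.+1%:R / b%:R ^+ i) 0 (d%:R / b%:R ^+ k) = d%:R.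
Proof.
move=> net ik ai; elim: d => [|d IH] dk; first by rewrite mul0r rcount_idr.
have d0 : (0 : R) <= d%:R / b%:R ^+ k by rewrite divr_ge0 ?exprn_ge0.
have dS : (d%:R / b%:R ^+ k : R) <= d.+1%:R / b%:R ^+ k.
  by rewrite ler_wpM2r ?invr_ge0 ?exprn_ge0// ler_nat.
by rewrite (rcount_catr _ _ _ d0 dS) (IH (ltnW dk)) (net_cell net) ?natr1.
Qed.

(** The same [j], depending only on [k] and [v], serves every strip; this is what lets its
    contribution cancel in [slice_step]. *)
Lemma strips_count (R : realType) (b m : nat) (x : 'I_(b ^ m) -> R * R)
    (k : nat) (v : R) : (0 < b)%N -> is_0m2_net b m (range x) -> 0 <= v <= 1 ->
  exists2 j, (j < b ^ k)%N & j%:R <= (b ^ k)%:R * v <= j.+1%:R /\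
  forall i p n, (i + k)%N = m -> (p + n <= b ^ i)%N ->
  j%:R * n%:R
    <= rcount x (p%:R / b%:R ^+ i) ((p + n)%N%:R / b%:R ^+ i) 0 v <=
  j.+1%:R * n%:R.
Proof.
move=> b0 net v01; have bk0 : (0 < b ^ k)%N by rewrite expn_gt0 b0.
have [j jk jv] := nat_cell bk0 v01; exists j => //; split=> // i p n ik.
have b0R : 0 < b%:R :> R by rewrite ltr0n.
have bk0R : 0 < b%:R ^+ k :> R by rewrite exprn_gt0.
move: (v01) jv => /andP[v0 v1]; rewrite natrX mulrC => /andP[].
rewrite -(ler_pdivrMr _ _ bk0R) => jv; rewrite -(ler_pdivlMr _ _ bk0R) => vj.
elim: n => [|n IH] pn; first by rewrite addn0 rcount_id !mulr0 lexx.
have le_step (q : nat) : (q%:R / b%:R ^+ i : R) <= q.+1%:R / b%:R ^+ i.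
  by rewrite ler_wpM2r ?invr_ge0 ?exprn_ge0// ler_nat.
rewrite addnS in pn *; have {IH}/andP[IH1 IH2] := IH (ltnW pn).
have le_pn : (p%:R / b%:R ^+ i : R) <= (p + n)%N%:R / b%:R ^+ i.
  by rewrite ler_wpM2r ?invr_ge0 ?exprn_ge0// ler_nat leq_addr.
rewrite (rcount_catl _ _ _ le_pn (le_step _)).
(* The height [v] lies between [j / b^k] and [(j + 1) / b^k], below which the strip holds exactly
   [j] and [j + 1] points. *)
have r1 := strip_rows net ik pn (ltnW jk).
have r2 := strip_rows net ik pn jk.
rewrite (rcount_catr _ _ _ v0 vj) in r2.
have j0 : (0 : R) <= j%:R / b%:R ^+ k by rewrite divr_ge0 ?exprn_ge0.
rewrite -[n.+1%:R]natr1 !mulrDr !mulr1; apply/andP; split; apply: lerD => //.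
  by rewrite -[leLHS]r1 [leRHS](rcount_catr _ _ _ j0 jv) lerDl rcount_ge0.
by rewrite -[leRHS]r2 lerDl rcount_ge0.
Qed.

(** Induction on the number [k] of refinements left before strips reach width [b^-m]. *)
Lemma slice_discr (R : realType) (b m : nat) (x : 'I_(b ^ m) -> R * R)
    (v : R) (k i a : nat) (t : R) :
  (2 <= b)%N -> is_0m2_net b m (range x) -> 0 <= v <= 1 ->
  (i + k)%N = m -> (a < b ^ i)%N -> 0 <= t <= 1 ->
  `|rcount x (a%:R / b%:R ^+ i) ((a%:R + t) / b%:R ^+ i) 0 v
    - t * rcount x (a%:R / b%:R ^+ i) (a.+1%:R / b%:R ^+ i) 0 v|
  <= slice_bound b%:R k t.
Proof.
move=> b2 net v01; have b0 : (0 < b)%N by exact: ltnW.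
have b0R : 0 < b%:R :> R by rewrite ltr0n.
elim: k i a t => [|k IH] i a t ik ai /andP[t0 t1].
  (* Here [j < b ^ 0] forces [j = 0]: the strip has at most one point below [v]. With [p + q <= 1]
     points on the two sides of the cut, the error is at most the larger of [t] and [1 - t]. *)
  have [j] := strips_count 0 b0 net v01.
  rewrite expn0 ltnS leqn0 => /eqP -> [_ /(_ i a 1%N ik)]; rewrite addn1 => /(_ ai).
  have bi0 : 0 < b%:R ^+ i :> R by rewrite exprn_gt0.
  have h1 : (a%:R / b%:R ^+ i : R) <= (a%:R + t) / b%:R ^+ i.
    by rewrite ler_pM2r ?invr_gt0// lerDl.
  have h2 : ((a%:R + t) / b%:R ^+ i : R) <= a.+1%:R / b%:R ^+ i.
    by rewrite ler_pM2r ?invr_gt0// -natr1 lerD2l.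
  rewrite (rcount_catl _ _ _ h1 h2) mul0r mul1r => /andP[_].
  have := rcount_ge0 x (a%:R / b%:R ^+ i) ((a%:R + t) / b%:R ^+ i) 0 v.
  have := rcount_ge0 x ((a%:R + t) / b%:R ^+ i) (a.+1%:R / b%:R ^+ i) 0 v.
  move: (rcount _ _ _ _ _) (rcount _ _ _ _ _) => p q p0 q0 pq.
  have p1 : 0 <= t * p by apply: mulr_ge0.
  have p2 : 0 <= t * q by apply: mulr_ge0.
  have p3 : 0 <= (1 - t) * p by apply: mulr_ge0 => //; lra.
  have p4 : 0 <= (1 - t) * q by apply: mulr_ge0 => //; lra.
  have p5 : 0 <= t * (1 - p - q) by apply: mulr_ge0 => //; lra.
  have p6 : 0 <= (1 - t) * (1 - p - q) by apply: mulr_ge0 => //; lra.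
  rewrite /slice_bound ler_norml.
  by have [h|h] := ler0P (t - 2^-1); apply/andP; split; lra.
(* [j] is the child containing the cut, and [kap] the common lower count of all children. *)
have [j jb /andP[jt tj]] := nat_cell b0 (introT andP (conj t0 t1)).
have [kap _ [_ strips]] := strips_count k b0 net v01.
have ik' : (i.+1 + k)%N = m by rewrite addSnnS.
have ltc (l : nat) : (l < b)%N -> (a * b + l < b ^ i.+1)%N.
  move=> lb; rewrite expnSr; apply: (@leq_trans (a.+1 * b)).
    by rewrite mulSn addnC ltn_add2r.
  by rewrite leq_mul2r ai orbT.
have cE (c : R) : c / b%:R ^+ i = c * b%:R / b%:R ^+ i.+1.
  by rewrite exprSr; field; rewrite ?expf_neq0 ?gt_eqF.
set y := b%:R * t - j%:R.
have y01 : 0 <= y <= 1 by rewrite /y; move: tj; rewrite -natr1; lra.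
have := IH _ _ _ ik' (ltc _ jb) y01.
have aE : a%:R / b%:R ^+ i = (a * b)%N%:R / b%:R ^+ i.+1 :> R by rewrite cE natrM.
have aSE : a.+1%:R / b%:R ^+ i =
    ((a * b + j).+1 + (b - j.+1))%N%:R / b%:R ^+ i.+1 :> R.
  by rewrite cE -natrM; congr (_%:R / _); rewrite -addnS -addnA subnKC// mulSnr.
have atE : (a%:R + t) / b%:R ^+ i =
    ((a * b + j)%N%:R + y) / b%:R ^+ i.+1 :> R.
  by rewrite cE natrD natrM /y; congr (_ / _); ring.
have bi0 : 0 < (b%:R ^+ i.+1)^-1 :> R by rewrite invr_gt0 exprn_gt0.
rewrite aE aSE atE => e.
have [y0 y1] := andP y01.
have le1 : ((a * b)%N%:R / b%:R ^+ i.+1 : R) <= (a * b + j)%N%:R / b%:R ^+ i.+1.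
  by rewrite ler_pM2r// ler_nat leq_addr.
have le2 : ((a * b + j)%N%:R / b%:R ^+ i.+1 : R)
    <= ((a * b + j)%N%:R + y) / b%:R ^+ i.+1 by rewrite ler_pM2r// lerDl.
have le3 : ((a * b + j)%N%:R / b%:R ^+ i.+1 : R)
    <= (a * b + j).+1%:R / b%:R ^+ i.+1 by rewrite ler_pM2r// ler_nat.
have le4 : ((a * b + j).+1%:R / b%:R ^+ i.+1 : R)
    <= ((a * b + j).+1 + (b - j.+1))%N%:R / b%:R ^+ i.+1.
  by rewrite ler_pM2r// ler_nat leq_addr.
(* The strip splits into the [j] children left of the cut, the cut child and the [b - j - 1]
   children to the right. *)
rewrite (rcount_catl _ _ _ le1 le2) (rcount_catl _ _ _ (le_trans le1 le3) le4).
rewrite (rcount_catl _ _ _ le1 le3).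
have abj : ((a * b + j).+1 + (b - j.+1) <= b ^ i.+1)%N.
  by rewrite -addnS -addnA subnKC// -mulSnr expnSr leq_mul2r ai orbT.
have sl := strips _ _ _ ik' (ltnW (ltc _ jb)).
have := strips i.+1 (a * b + j)%N 1%N ik'.
rewrite addn1 !mulr1 => /(_ (ltc _ jb)) sm.
have sr := strips _ _ _ ik' abj.
apply: le_trans (slice_bound_step k _ _ y01); rewrite ?t0 ?ler_nat//.
have t01 : 0 <= t <= 1 by rewrite t0.
have rE : (b - j.+1)%N%:R = b%:R - 1 - j%:R :> R.
  by rewrite natrB// -natr1; ring.
have kE : kap.+1%:R = kap%:R + 1 :> R by rewrite natr1.
rewrite ?rE kE in sl sm sr.
exact: slice_step t01 _ sl sm sr e.
Qed.

Lemma net_star_count (R : realType) (b m : nat) (x : 'I_(b ^ m) -> R * R)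
    (t v : R) : (2 <= b)%N -> (1 <= m)%N -> is_0m2_net b m (range x) ->
  0 <= t <= 1 -> 0 <= v <= 1 ->
  `|rcount x 0 t 0 v - (b ^ m)%:R * (t * v)|
    <= b%:R ^+ 2 / (4 * (b%:R + 1)) * m%:R + 9 / 4.
Proof.
move=> b2 m1 net t01 v01; have b0 : (0 < b)%N by exact: ltnW.
have := slice_discr b2 net v01 (add0n m) (ltn0Sn 0) t01.
rewrite expr0 !divr1 add0r -[1%:R]/(1 : R).
(* The number of points below [v] and [b^m * v] both lie in [[j, j + 1]]. This adds at most 1 to the
   [5 / 4] of [slice_bound], hence [9 / 4]. *)
have [j _ [jv]] := strips_count m b0 net v01.
move=> /(_ 0%N 0%N 1%N (add0n m) (leqnn 1)).
rewrite !expr0 !divr1 !mulr1 add0n => sE.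
case: m m1 x net jv sE => // m _ x net jv sE.
rewrite /slice_bound; set c := _ / (4 * _).
have bsq : 0 <= (b%:R : R) / 2 * (t - 2^-1) ^+ 2 by rewrite mulr_ge0 ?sqr_ge0.
move: jv sE t01 bsq; rewrite -natr1; set X := rcount _ _ 1 _ _.
set N := _%:R * v; set Q := _ * _ ^+ 2 => /andP[? ?] /andP[? ?] /andP[t0 t1] Q0.
have p1 : 0 <= t * (1 - (X - N)) by apply: mulr_ge0 => //; lra.
have p2 : 0 <= t * (1 - (N - X)) by apply: mulr_ge0 => //; lra.
rewrite mulrCA -/N !ler_norml => /andP[? ?]; apply/andP; split; lra.
Qed.

(** * Transfer from the sphere to the unit square *)

(** The normalized area of the polar cap of colatitude [pi * phi]; its boundary circle is the image
    under [Phi] of the segment at this height. *)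
Definition cap_area (R : realType) (phi : R) : R := (1 - cos (pi * phi)) / 2.

Lemma piM_itv (R : realType) (phi : R) : 0 <= phi <= 1 -> pi * phi \in `[0, pi].
Proof.
by move=> /andP[? ?]; rewrite in_itv /= mulr_ge0 ?pi_ge0//= ler_piMr ?pi_ge0.
Qed.

Lemma cap_area_le (R : realType) (phi psi : R) :
  0 <= phi <= 1 -> 0 <= psi <= 1 ->
  (cap_area phi <= cap_area psi) = (phi <= psi).
Proof.
move=> phi01 psi01; rewrite /cap_area ler_pM2r ?invr_gt0// lerD2l lerN2.
rewrite !leNgt ltr_cos ?piM_itv// ltr_pM2l ?pi_gt0//.
Qed.

Lemma cap_area_itv (R : realType) (phi : R) : 0 <= cap_area phi <= 1.
Proof.
rewrite /cap_area.
by have := cos_le1 (pi * phi); have := cos_geN1 (pi * phi); lra.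
Qed.

Lemma cap_area_surj (R : realType) (t : R) : 0 <= t <= 1 ->
  exists2 phi, 0 <= phi <= 1 & cap_area phi = t.
Proof.
move=> /andP[t0 t1]; have t11 : -1 <= 1 - 2 * t <= 1 by lra.
exists (acos (1 - 2 * t) / pi).
  rewrite divr_ge0 ?acos_ge0 ?pi_ge0//= ler_pdivrMr ?pi_gt0// mul1r.
  exact: acos_lepi.
rewrite /cap_area mulrCA divff ?gt_eqF ?pi_gt0// mulr1 acosK ?in_itv//=.
by field.
Qed.

(** The hypotheses give [cos (2 * pi * (s - t)) = 1], so [sin (pi * (s - t))] vanishes, which is
    impossible for [0 < s - t < 1]. *)
Lemma cos_sin_inj (R : realType) (s t : R) : 0 <= s < 1 -> 0 <= t < 1 ->
  cos (2 * pi * s) = cos (2 * pi * t) -> sin (2 * pi * s) = sin (2 * pi * t) ->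
  s = t.
Proof.
wlog st : s t / t <= s => [hw|] s01 t01 cE sE.
  by have [/hw|/ltW/hw] := leP t s => h; [apply: h|apply/esym/h].
have [->//|ts] := eqVneq s t.
have dE : cos (2 * pi * (s - t)) = 1.
  by rewrite mulrBr cosB cE sE -!expr2 cos2Dsin2.
have : 0 < sin (pi * (s - t)).
  apply: sin_gt0_pi; have := @pi_gt0 R => p0.
  have d0 : 0 < s - t by rewrite subr_gt0 lt_neqAle eq_sym ts.
  rewrite mulr_gt0//= gtr_pMr//; lra.
have : cos (2 * pi * (s - t)) = 1 - 2 * sin (pi * (s - t)) ^+ 2.
  rewrite -mulrA mulr_natl cos_mulr2n.
  have := cos2Dsin2 (pi * (s - t)); lra.
rewrite dE => h sn0; have : 0 < sin (pi * (s - t)) ^+ 2 by rewrite exprn_gt0.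
lra.
Qed.

Lemma sin_cap_area (R : realType) (phi : R) : 0 <= phi <= 1 ->
  sin (pi * phi) = 2 * Num.sqrt (cap_area phi - cap_area phi ^+ 2).
Proof.
move=> phi01; have s0 : 0 <= sin (pi * phi).
  by apply: sin_ge0_pi; have := piM_itv phi01; rewrite in_itv.
have -> : cap_area phi - cap_area phi ^+ 2 = (sin (pi * phi) / 2) ^+ 2.
  rewrite /cap_area; have := cos2Dsin2 (pi * phi).
  move: (cos _) (sin _) => c s csE.
  have s2E : s ^+ 2 = 1 - c ^+ 2 by lra.
  rewrite [RHS]expr_div_n s2E.
  by field.
by rewrite sqrtr_sqr ger0_norm ?divr_ge0//; field.
Qed.

Lemma sph_eq (R : realType) (s phi : R) : 0 <= phi <= 1 ->
  sph s phi = Phi (s, cap_area phi).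
Proof.
move=> phi01; rewrite /sph /Phi /= sin_cap_area//.
have -> : 1 - 2 * cap_area phi = cos (pi * phi) by rewrite /cap_area; field.
by congr (vec3 _ _ _); ring.
Qed.

Lemma vec3_inj (R : realType) (x y z x' y' z' : R) :
  vec3 x y z = vec3 x' y' z' -> [/\ x = x', y = y' & z = z'].
Proof.
move=> /rowP h.
by split; [have := h 0|have := h 1|have := h 2]; rewrite !mxE.
Qed.

(* Injectivity fails at the poles [x.2 = 0] and [x.2 = 1]. *)
Lemma Phi_inj (R : realType) (p q : R * R) :
  0 <= p.1 < 1 -> 0 <= q.1 < 1 -> 0 < q.2 < 1 -> Phi p = Phi q -> p = q.
Proof.
case: p q => [p1 p2] [q1 q2] /= p01 q01 /andP[q20 q21].
move=> /vec3_inj[/= cE sE zE].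
have {zE} p2E : p2 = q2 by lra.
subst p2.
have s0 : Num.sqrt (q2 - q2 ^+ 2) != 0.
  by rewrite gt_eqF// sqrtr_gt0; nra.
by congr (_, _); apply: cos_sin_inj => //;
  [move: cE|move: sE] => /(mulIf s0)/mulfI; apply.
Qed.

(** By [sph_eq], [Omega] is the image under [Phi] of a box. Injectivity of [Phi] away from the poles
    recovers [p] from its image; surjectivity of [cap_area] supplies the angle for the converse. *)
Lemma Omega_Phi (R : realType) (p : R * R) (s t phi psi : R) :
  0 <= s -> t <= 1 -> 0 <= phi <= 1 -> 0 <= psi <= 1 ->
  0 < p.1 < 1 -> 0 < p.2 < 1 ->
  \1_(Omega s t phi psi) (Phi p) =
  (s <= p.1 < t)%R%:R * (cap_area phi <= p.2 < cap_area psi)%R%:R :> R.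
Proof.
move=> s0 t1 phi01 psi01 p1 p2; rewrite indicE -natrM mulnb.
congr (nat_of_bool _)%:R; apply/idP/idP.
  rewrite inE => -[th]; rewrite /= in_itv/= => /andP[sth tht] [ph].
  rewrite /= in_itv/= => /andP[phiph phpsi].
  have ph01 : 0 <= ph <= 1 by lra.
  have th01 : 0 <= th < 1 by lra.
  have p1' : 0 <= p.1 < 1 by lra.
  rewrite sph_eq// => /Phi_inj <- //=.
  by rewrite sth tht cap_area_le// phiph ltNge cap_area_le// -ltNge.
move=> /andP[/andP[sp pt] p2itv].
have p2' : 0 <= p.2 <= 1 by case/andP: p2 => ? ?; rewrite !ltW.
have [ph ph01 phE] := cap_area_surj p2'.
move: p2itv; rewrite -phE cap_area_le// ltNge cap_area_le// -ltNge => phitv.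
rewrite inE; exists p.1; first by rewrite /= in_itv/= sp.
exists ph; first by rewrite /= in_itv.
by rewrite sph_eq// phE; case: (p).
Qed.

Lemma local_discr_Phi (R : realType) (N : nat) (x : 'I_N -> R * R)
    (s t phi psi : R) : range x `<=` `]0, 1[ `*` `]0, 1[ -> (0 < N)%N ->
  0 <= s -> t <= 1 -> 0 <= phi <= 1 -> 0 <= psi <= 1 ->
  N%:R * local_discr (fun n => Phi (x n)) s t phi psi =
  `|rcount x s t (cap_area phi) (cap_area psi)
    - N%:R * ((t - s) * (cap_area psi - cap_area phi))|.
Proof.
move=> hx N0 s0 t1 phi01 psi01; have N0R : 0 < N%:R :> R by rewrite ltr0n.
rewrite /local_discr -[X in X * _](gtr0_norm N0R) -normrM mulrBr mulVKf ?gt_eqF//.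
congr `| _ - _ * _|; last by rewrite /Gamma /cap_area; field.
apply: eq_bigr => n _; have [|/=] := hx (x n); first by exists n.
by rewrite /= !in_itv/= => x1 x2; rewrite Omega_Phi.
Qed.

(** * Discrepancy bounds on the sphere *)

Lemma net_star_local (R : realType) (b m : nat) (x : 'I_(b ^ m) -> R * R)
    (t phi : R) : (2 <= b)%N -> (1 <= m)%N ->
  range x `<=` `]0, 1[ `*` `]0, 1[ -> is_0m2_net b m (range x) ->
  0 <= t <= 1 -> 0 <= phi <= 1 ->
  (b ^ m)%:R * local_discr (fun n => Phi (x n)) 0 t 0 phi
  <= b%:R ^+ 2 / (4 * (b%:R + 1)) * m%:R + 9 / 4.
Proof.
move=> b2 m1 hx net /andP[t0 t1] phi01.
have cap0 : cap_area (0 : R) = 0 by rewrite /cap_area mulr0 cos0 subrr mul0r.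
rewrite local_discr_Phi ?expn_gt0 ?(ltnW b2) ?lexx ?ler01//.
rewrite cap0 !subr0; apply: net_star_count; rewrite ?t0 ?cap_area_itv//.
Qed.

(** Inclusion-exclusion over four boxes anchored at the origin, whence the factor 4. *)
Lemma net_extreme_local (R : realType) (b m : nat) (x : 'I_(b ^ m) -> R * R)
    (s t phi psi : R) : (2 <= b)%N -> (1 <= m)%N ->
  range x `<=` `]0, 1[ `*` `]0, 1[ -> is_0m2_net b m (range x) ->
  0 <= s < t -> t <= 1 -> 0 <= phi < psi -> psi <= 1 ->
  (b ^ m)%:R * local_discr (fun n => Phi (x n)) s t phi psi
  <= 4 * (b%:R ^+ 2 / (4 * (b%:R + 1)) * m%:R + 9 / 4).
Proof.
move=> b2 m1 hx net /andP[s0 /ltW st] t1 /andP[phi0 /ltW phipsi] psi1.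
have phi01 : 0 <= phi <= 1 by rewrite phi0 (le_trans phipsi).
have psi01 : 0 <= psi <= 1 by rewrite psi1 (le_trans phi0).
have s01 : 0 <= s <= 1 by rewrite s0 (le_trans st).
have t01 : 0 <= t <= 1 by rewrite t1 (le_trans s0).
rewrite local_discr_Phi ?expn_gt0 ?(ltnW b2)//.
have := cap_area_le phi01 psi01; rewrite phipsi.
have := cap_area_itv phi; have := cap_area_itv psi.
move: (cap_area phi) (cap_area psi) => u v v01 u01 uv.
have [u0 _] := andP u01.
have := net_star_count b2 m1 net s01 u01; have := net_star_count b2 m1 net t01 u01.
have := net_star_count b2 m1 net s01 v01; have := net_star_count b2 m1 net t01 v01.
rewrite (rcount_catl _ _ _ s0 st) (rcount_catr _ _ _ u0 uv).
rewrite (rcount_catr _ s t u0 uv) (rcount_catl x 0 u s0 st).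
set c := _ + 9 / 4; set p := rcount _ 0 s 0 u; set q := rcount _ 0 s u v.
set r := rcount _ s t 0 u; set w := rcount _ s t u v; set N := _%:R.
rewrite !ler_norml => /andP[? ?] /andP[? ?] /andP[? ?] /andP[? ?].
by apply/andP; split; lra.
Qed.

(** The supremum of the empty set is 0 by convention, so [0 <= c] replaces a proof of
    nonemptiness. *)
Lemma sup_le_ub (R : realType) (E : set R) (c : R) :
  0 <= c -> ubound E c -> sup E <= c.
Proof.
move=> c0 Ec; have [->|/set0P E0] := eqVneq E set0; first by rewrite sup0.
exact: ge_sup.
Qed.

Theorem theorem1 (R : realType) (b m : nat) (hb : (2 <= b)%N) (hm : (1 <= m)%N)
    (x : 'I_(b ^ m) -> R * R)
    (hx : range x `<=` `]0, 1[ `*` `]0, 1[)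
    (hnet : is_0m2_net b m (range x)) :
  let B : R := b%:R in
  let z := fun n : 'I_(b ^ m) => Phi (x n) in
  discr z <=
    B ^+ 2 / (B + 1) * (m%:R / B ^+ m)
    + 1 / B ^+ m * (9 + 4 / B)
    + 1 / B ^+ (2 * m) * (2 * B - 1 - (4 * B + 3) / (B + 1) ^+ 2)
  /\
  star_discr z <=
    B ^+ 2 / (B + 1) * (m%:R / (4 * B ^+ m))
    + 1 / B ^+ m * (9 / 4 + 1 / B)
    + 1 / B ^+ (2 * m)
      * (B / 2 - 1 / 4 - (4 * B + 3) / (4 * (B + 1) ^+ 2)).
Proof.
move=> B z; have b0 : (0 < b)%N by exact: ltnW.
have B2 : 2 <= B by rewrite ler_nat.
have N0 : 0 < B ^+ m by rewrite exprn_gt0//; lra.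
pose c := B ^+ 2 / (4 * (B + 1)) * m%:R + 9 / 4.
have c0 : 0 <= c.
  by rewrite addr_ge0// mulr_ge0// divr_ge0 ?sqr_ge0// mulr_ge0//; lra.
have cN0 : 0 <= c / B ^+ m by rewrite divr_ge0// ltW.
(* The argument yields the bound [c / B ^+ m]; [rest] is the amount by which the stated star bound
   exceeds it. *)
pose rest := 1 / B ^+ m / B
  + (B / 2 - 1 / 4 - (4 * B + 3) / (4 * (B + 1) ^+ 2)) / B ^+ (2 * m).
have rest0 : 0 <= rest.
  have B0 : 0 < B by lra.
  apply: addr_ge0; first by rewrite !divr_ge0// ltW.
  apply: divr_ge0; last by rewrite ltW// exprn_gt0.
  (* At [B = 2] the left side is 11/36; meanwhile [B / 2 - 1 / 4] is at least 3/4. *)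
  have : (4 * B + 3) / (4 * (B + 1) ^+ 2) <= 1 / 3.
    by rewrite ler_pdivrMr; nra.
  lra.
have starE : B ^+ 2 / (B + 1) * (m%:R / (4 * B ^+ m))
    + 1 / B ^+ m * (9 / 4 + 1 / B)
    + 1 / B ^+ (2 * m) * (B / 2 - 1 / 4 - (4 * B + 3) / (4 * (B + 1) ^+ 2))
    = c / B ^+ m + rest.
  rewrite /rest /c; move: N0; rewrite mulnC exprM; move: (B ^+ m) => M M0.
  by field; rewrite !gt_eqF//; lra.
split; last first.
  rewrite starE; apply: sup_le_ub => [|_ [t [phi [t01 phi01 ->]]]].
    exact: addr_ge0.
  rewrite -[leLHS]addr0 lerD// ler_pdivlMr// mulrC -natrX.
  exact: net_star_local.
(* The stated extreme bound is exactly four times the star bound. *)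
have -> : B ^+ 2 / (B + 1) * (m%:R / B ^+ m) + 1 / B ^+ m * (9 + 4 / B)
    + 1 / B ^+ (2 * m) * (2 * B - 1 - (4 * B + 3) / (B + 1) ^+ 2)
    = 4 * (c / B ^+ m + rest).
  rewrite /rest /c; move: N0; rewrite mulnC exprM; move: (B ^+ m) => M M0.
  by field; rewrite !gt_eqF//; lra.
apply: sup_le_ub => [|_ [s [t [phi [psi [st t1 phipsi psi1 ->]]]]]].
  by rewrite mulr_ge0// addr_ge0.
rewrite mulrDr -[leLHS]addr0 lerD ?mulr_ge0// mulrA ler_pdivlMr// mulrC -natrX.
exact: net_extreme_local.
Qed.
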